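(* Let $n\ge3$ and let $A,B$ be real symmetric $n\times n$ matrices with $B=\Sigma(A)$ for some hypomorphism $\Sigma$. Let $\lambda_0\in\mathbb R$ be such that for every $\lambda\ge\lambda_0$ there exist real numbers $s,s'$ for which $A+\lambda I+sJ$ and $B+\lambda I+s'J$ are positive semidefinite and have presentations in good position. Fix $\lambda\ge\lambda_0$, and let $t_1,t_2$ be real numbers such that $A+\lambda I+t_1J$ and $B+\lambda I+t_2J$ are positive semidefinite and have presentations in good position. Then $t_1=t_2$.
   Context: For an $n\times n$ matrix $M$, $M_i$ denotes the matrix obtained by deleting the $i$-th row and column. $B=\Sigma(A)$ (hypomorphic) means there exist $(n-1)\times(n-1)$ permutation matrices $\sigma_1,\dots,\sigma_n$ with $B_i=\sigma_iA_i\sigma_i^t$ for all $i$. A presentation of a real symmetric positive semidefinite $n\times n$ matrix $M=(m_{ij})$ is an ordered set $U=\{u_1,\dots,u_n\}\subset\mathbb R^n$ with $(u_i,u_j)=m_{ij}$; $U$ is in good position if its convex hull has dimension $n-1$ and contains the origin in its interior (relative to its affine hull). $J$ is the $n\times n$ all-ones matrix. *)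

(* Defs.v *)
From HB Require Import structures.
From mathcomp Require Import all_boot all_order all_algebra.
From mathcomp Require Import all_classical reals topology normedtype.

Set Implicit Arguments.
Unset Strict Implicit.
Unset Printing Implicit Defensive.

Import Order.TTheory GRing.Theory Num.Theory.
Import numFieldNormedType.Exports.
Local Open Scope classical_set_scope.
Local Open Scope ring_scope.

Definition symmetric_mx (R : realType) (n : nat) (M : 'M[R]_n) : Prop :=
  M^T = M.

Definition psd_mx (R : realType) (n : nat) (M : 'M[R]_n) : Prop :=
  symmetric_mx M /\ forall x : 'rV[R]_n, 0 <= (x *m M *m x^T) 0 0.

Definition delete_mx (R : realType) (n : nat) (i : 'I_n) (M : 'M[R]_n) :
  'M[R]_n.-1 := row' i (col' i M).

Definition hypomorphic (R : realType) (n : nat) (A B : 'M[R]_n) : Prop :=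
  exists sigma : 'I_n -> 'M[R]_n.-1, forall i : 'I_n,
    is_perm_mx (sigma i) /\
    delete_mx i B = sigma i *m delete_mx i A *m (sigma i)^T.

Definition all_ones_mx (R : realType) (n : nat) : 'M[R]_n := const_mx 1.

Definition inner (R : realType) (n : nat) (u v : 'rV[R]_n) : R :=
  \sum_(k < n) u 0 k * v 0 k.

Definition convex_hull (R : realType) (n : nat) (S : set 'rV[R]_n) :
    set 'rV[R]_n :=
  [set x | exists (m : nat) (p : 'I_m -> 'rV[R]_n) (a : 'I_m -> R),
    [/\ forall i, S (p i), forall i, 0 <= a i,
        \sum_(i < m) a i = 1 & x = \sum_(i < m) a i *: p i]].

Definition affine_hull (R : realType) (n : nat) (S : set 'rV[R]_n) :
    set 'rV[R]_n :=
  [set x | exists (m : nat) (p : 'I_m -> 'rV[R]_n) (a : 'I_m -> R),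
    [/\ forall i, S (p i),
        \sum_(i < m) a i = 1 & x = \sum_(i < m) a i *: p i]].

(* The dimension of a set is that of its affine hull; this is a relation, and
   no [d] is a dimension of the empty set. *)
Definition has_dimension (R : realType) (n : nat) (S : set 'rV[R]_n)
    (d : nat) : Prop :=
  exists (p : 'rV[R]_n) (W : {vspace 'rV[R]_n}),
    \dim W = d /\ affine_hull S = [set p + w | w in [set w | w \in W]].

(* The library topology on ['rV[R]_n] is that of the sup norm, which is the
   Euclidean one. *)
Definition relative_interior (R : realType) (n : nat) (S : set 'rV[R]_n) :
    set 'rV[R]_n :=
  [set x | S x /\ within (affine_hull S) (nbhs x) S].

Definition is_presentation (R : realType) (n : nat) (M : 'M[R]_n)
    (u : 'I_n -> 'rV[R]_n) : Prop :=
  forall i j : 'I_n, inner (u i) (u j) = M i j.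

Definition good_position (R : realType) (n : nat) (u : 'I_n -> 'rV[R]_n) :
    Prop :=
  has_dimension (convex_hull (range u)) n.-1 /\
  relative_interior (convex_hull (range u)) 0.

Definition has_good_presentation (R : realType) (n : nat) (M : 'M[R]_n) :
    Prop :=
  exists u : 'I_n -> 'rV[R]_n, is_presentation M u /\ good_position u.

(* Main.v *)
Require Import Defs.
From HB Require Import structures.
From mathcomp Require Import all_boot all_order all_algebra.
From mathcomp Require Import all_classical reals topology normedtype.
From mathcomp Require Import fingroup perm zify ring lra.

Set Implicit Arguments.
Unset Strict Implicit.
Unset Printing Implicit Defensive.

Import Order.TTheory GRing.Theory Num.Theory.
Local Open Scope ring_scope.

(** The proof reduces to Tutte's theorem that symmetric matrices with the same
    deck have the same characteristic polynomial.  Let [M = X - A],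
    [f = det M], [g = 1^T adj(M) 1 = det (M + J) - f], and let [y] be the
    vector [adj(M) 1], so [sum_i y_i = g]; write [D_i] and [G_i] for the
    analogues of [f] and [g] for the [i]-th vertex-deleted matrix.  Jacobi's
    identity gives [y_i^2 = g D_i - f G_i].  Since [f' = sum_i D_i], passing
    to a hypomorphic [B] changes [f] and [g] only by constants [c0] and [c1],
    so [(y_i^A - y_i^B) (y_i^A + y_i^B) = c1 D_i - c0 G_i].  Here [y_i] and
    [D_i] are monic of degree [n - 1] and [G_i] has degree [n - 2]; hence
    [y_i^A - y_i^B = c1 / 2], and summing over [i] gives [n c1 / 2 = c1].
    For [n > 2] this forces [c1 = 0], and then [c0 = 0].

    Good position of [P = A + lambda I + t J] forces [det P = 0] and
    [det (P + J) <> 0]; as [det (A + lambda I + t J)] is affine in [t], with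
    coefficients determined by [f] and [g], this determines [t]. *)

(** * Determinants of low-rank perturbations *)

(** The matrix determinant lemma with denominators cleared: the adjugate replaces the inverse
    because the entries will be polynomials. The block matrix with rows [M, -U] and [V, 1] has
    determinant [\det (M + U *m V)], and right multiplication by a block matrix built from [\adj M]
    makes it lower triangular. *)
Lemma det_add_mulmx (S : idomainType) (n k : nat) (M : 'M[S]_n)
    (U : 'M[S]_(n, k)) (V : 'M[S]_(k, n)) : \det M != 0 ->
  \det M ^+ k * \det (M + U *m V) =
  \det M * \det ((\det M)%:M + V *m \adj M *m U).
Proof.
move=> f0; set f := \det M in f0 *.
have E1 : \det (block_mx M (- U) V 1%:M) = \det (M + U *m V).
  have dL : \det (block_mx 1%:M 0 (- V) 1%:M : 'M[S]_(n + k)) = 1.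
    by rewrite det_lblock !det1 mulr1.
  have dU : \det (block_mx (M + U *m V) (- U) 0 1%:M) = \det (M + U *m V).
    by rewrite det_ublock det1 mulr1.
  rewrite -dU -[LHS]mulr1 -[X in _ * X]dL -det_mulmx; congr (\det _).
  by rewrite mulmx_block !mulmx1 !mulmx0 mul1mx !add0r mulNmx mulmxN opprK
    subrr.
have E2 : block_mx M (- U) V 1%:M *m block_mx (\adj M) (\adj M *m U) 0 f%:M =
          block_mx f%:M 0 (V *m \adj M) (f%:M + V *m \adj M *m U).
  rewrite mulmx_block !mulmx0 !addr0 !mulmxA mul_mx_adj mul1mx addrC.
  congr block_mx; first by rewrite mulNmx mul_scalar_mx mul_mx_scalar addNr.
  by rewrite addrC.
(* The factor [f] avoids the exponent [n - 1], so [n = 0] needs no separate case. *)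
have E3 : \det (\adj M) * f = f ^+ n.
  by rewrite -det_mulmx mul_adj_mx det_scalar.
have := congr1 determinant E2.
rewrite det_mulmx E1 det_ublock det_lblock !det_scalar => E4.
apply: (mulfI (expf_neq0 n f0)); rewrite [RHS]mulrCA -E4 -E3; ring.
Qed.

Lemma det_add_rank1 (S : idomainType) (n : nat) (M : 'M[S]_n)
    (u : 'cV[S]_n) (v : 'rV[S]_n) : \det M != 0 ->
  \det (M + u *m v) = \det M + (v *m \adj M *m u) 0 0.
Proof.
move=> f0; apply: (mulfI f0); have := det_add_mulmx u v f0.
by rewrite expr1 => ->; rewrite det_mx11 !mxE eqxx.
Qed.

Lemma det_block_mx11 (S : comNzRingType) (a b c d : 'M[S]_1) :
  \det (block_mx a b c d) = a 0 0 * d 0 0 - b 0 0 * c 0 0.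
Proof.
rewrite (expand_det_row _ (lshift 1 0)) big_split_ord !big_ord1.
rewrite block_mxEul block_mxEur /cofactor !det_mx11 !mxE /=.
rewrite -[in RHS](mulrN (b 0 0)); congr (_ * _ + _ * _).
- rewrite expr0 mul1r; rewrite (_ : lift _ _ = rshift 1 0); last exact/val_inj.
  by rewrite (unsplitK (inr _)) row_mxEr.
- rewrite expr1 mulN1r (_ : lift (lshift 1 0) _ = rshift 1 0);
    last exact/val_inj.
  rewrite (_ : lift _ _ = lshift 1 0); last exact/val_inj.
  by rewrite (unsplitK (inr _)) row_mxEl.
Qed.

(* Jacobi's identity for the 2x2 minors of the adjugate, in the form given by
   adding the rank-two matrix [u u^T + v v^T] to [M]. *)
Lemma det_add_rank2_sym (S : idomainType) (n : nat) (M : 'M[S]_n)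
    (u v : 'cV[S]_n) : \det M != 0 -> M^T = M ->
  \det M * \det (M + u *m u^T + v *m v^T) =
  (\det M + (u^T *m \adj M *m u) 0 0) * (\det M + (v^T *m \adj M *m v) 0 0)
  - (v^T *m \adj M *m u) 0 0 ^+ 2.
Proof.
move=> f0 sM; apply: (mulfI f0).
have := det_add_mulmx (row_mx u v) (col_mx u^T v^T) f0.
rewrite expr2 -mulrA mul_row_col addrA => ->; congr (_ * _).
rewrite mul_col_mx mul_col_row scalar_mx_block add_block_mx.
have entry a (X : 'M[S]_1) : (a%:M + X) 0 0 = a + X 0 0 by rewrite !mxE.
rewrite det_block_mx11 !entry !add0r; congr (_ * _ - _).
have -> : u^T *m \adj M *m v = (v^T *m \adj M *m u)^T.
  by rewrite !trmx_mul trmxK trmx_adj sM mulmxA.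
by rewrite mxE.
Qed.

(** * Derivatives and coefficients of characteristic polynomials *)

Lemma deriv_prod (S : comNzRingType) (I : eqType) (r : seq I)
    (F : I -> {poly S}) : uniq r ->
  (\prod_(i <- r) F i)^`() =
  \sum_(i <- r) (F i)^`() * \prod_(j <- r | j != i) F j.
Proof.
elim: r => [|x r IHr] /=; first by rewrite !big_nil derivC.
case/andP=> xr /IHr{}IHr; rewrite !big_cons derivM IHr eqxx /=.
have xN j : j \in r -> j != x by apply: contraTneq => ->.
congr (_ * _ + _).
  rewrite big_seq [RHS]big_seq_cond; apply: eq_bigl => j.
  by case: (boolP (j \in r)) => //= /xN ->.
rewrite big_distrr /= !big_seq; apply: eq_bigr => i ir.
by rewrite big_cons eq_sym xN //= mulrCA.
Qed.

(** The determinant is differentiated row by row. Row [i] of [X - A] has derivative the unit vector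
    [e_i]; putting it in place of that row gives [N i], and expansion along it leaves the [i]-th
    principal minor. *)
Lemma deriv_char_poly (S : comNzRingType) (n : nat) (A : 'M[S]_n) :
  (char_poly A)^`() = \sum_i char_poly (row' i (col' i A)).
Proof.
pose M := char_poly_mx A.
have dM i j : (M i j)^`() = (i == j)%:R.
  by rewrite !mxE derivB derivC subr0 derivMn derivX.
rewrite /char_poly -/M /determinant raddf_sum /=.
pose N i := \matrix_(k, l) if k == i then (k == l)%:R else M k l.
transitivity (\sum_i \det (N i)); last first.
  apply: eq_bigr => i _; rewrite -row'_col'_char_poly_mx (expand_det_row _ i).
  rewrite (bigD1 i) //= big1 ?addr0 => [|j ji]; last first.
    by rewrite !mxE eqxx eq_sym (negPf ji) mul0r.
  rewrite !mxE !eqxx mul1r /cofactor -signr_odd addnn odd_double mul1r.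
  congr (\det _); apply/matrixP=> k l.
  by rewrite !mxE eq_sym (negPf (neq_lift _ _)).
rewrite /determinant exchange_big /=; apply: eq_bigr => s _.
rewrite -mulr_sumr.
have -> p (b : bool) : ((-1) ^+ b * p)^`() = (-1) ^+ b * p^`() :> {poly S}.
  by case: b; rewrite ?expr0 ?expr1 ?mul1r // !mulN1r derivN.
congr (_ * _); rewrite deriv_prod ?index_enum_uniq //.
apply: eq_bigr => i _; rewrite [RHS](bigD1 i) //= dM mxE eqxx; congr (_ * _).
by apply: eq_bigr => j ji; rewrite [RHS]mxE (negPf ji).
Qed.

Lemma deriv_eq0_polyC (R : numDomainType) (p : {poly R}) :
  p^`() = 0 -> p = (p`_0)%:P.
Proof.
move=> p0; apply/polyP=> -[|i]; rewrite coefC //=.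
have /eqP := congr1 (fun q : {poly R} => q`_i) p0.
by rewrite coef_deriv coef0 mulrn_eq0 /= => /eqP.
Qed.

Lemma size_char_polyB (S : idomainType) (n : nat) (A B : 'M[S]_n) :
  (size (char_poly A - char_poly B)%R <= n)%N.
Proof.
apply/leq_sizeP => j; rewrite leq_eqVlt => /predU1P[<-|nj].
  have mon (C : 'M[S]_n) : (char_poly C)`_n = 1.
    by have := monicP (char_poly_monic C); rewrite /lead_coef size_char_poly.
  by rewrite coefB !mon subrr.
by rewrite coefB !nth_default ?subrr // size_char_poly.
Qed.

Lemma coef_char_polyB (S : idomainType) (n : nat) (A B : 'M[S]_n) :
  (char_poly (A - B) - char_poly A)`_n.-1 = \tr B.
Proof.
case: n A B => [|n] A B.
  by rewrite /char_poly !det_mx00 subrr coef0 /mxtrace big_ord0.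
rewrite coefB !char_poly_trace // raddfB /=; ring.
Qed.

(** * Characteristic polynomials under low-rank perturbations *)

Lemma det_char_poly_mx_neq0 (S : idomainType) (n : nat) (A : 'M[S]_n) :
  \det (char_poly_mx A) != 0.
Proof. exact: monic_neq0 (char_poly_monic A). Qed.

Definition adj_form (S : idomainType) (n : nat) (A : 'M[S]_n)
    (v : 'rV[S]_n) (u : 'cV[S]_n) : {poly S} :=
  (map_mx polyC v *m \adj (char_poly_mx A) *m map_mx polyC u) 0 0.

Lemma char_poly_mxB (S : idomainType) (n : nat) (A B : 'M[S]_n) :
  char_poly_mx (A - B) = char_poly_mx A + map_mx polyC B.
Proof. by rewrite /char_poly_mx map_mxB opprB addrA addrAC. Qed.

Lemma char_poly_rank1 (S : idomainType) (n : nat) (A : 'M[S]_n)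
    (u : 'cV[S]_n) (v : 'rV[S]_n) :
  char_poly (A - u *m v) = char_poly A + adj_form A v u.
Proof.
rewrite /char_poly char_poly_mxB map_mxM.
by rewrite det_add_rank1 ?det_char_poly_mx_neq0.
Qed.

(** The squared term is [adj_form A v^T u], written as a difference of characteristic polynomials so
    that the size and coefficient lemmas apply to it. *)
Lemma char_poly_rank2_sym (S : idomainType) (n : nat) (A : 'M[S]_n)
    (u v : 'cV[S]_n) : A^T = A ->
  char_poly A * char_poly (A - u *m u^T - v *m v^T) =
  char_poly (A - u *m u^T) * char_poly (A - v *m v^T)
  - (char_poly (A - u *m v^T) - char_poly A) ^+ 2.
Proof.
move=> sA; have rank1 := char_poly_rank1 A.
rewrite !rank1 [char_poly A + adj_form A v^T u]addrC addrK.
rewrite /char_poly !char_poly_mxB !map_mxM -!map_trmx.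
rewrite det_add_rank2_sym ?det_char_poly_mx_neq0 ?map_trmx //.
by rewrite /char_poly_mx linearB /= tr_scalar_mx map_trmx sA.
Qed.

Lemma adj_form_delta (S : idomainType) (n : nat) (A : 'M[S]_n) (i : 'I_n) :
  adj_form A (delta_mx 0 i) (delta_mx i 0) = char_poly (row' i (col' i A)).
Proof.
rewrite /adj_form !map_delta_mx -rowE -colE !mxE /cofactor.
by rewrite -signr_odd addnn odd_double mul1r row'_col'_char_poly_mx.
Qed.

Lemma char_poly_delta (S : idomainType) (n : nat) (A : 'M[S]_n) (i : 'I_n) :
  char_poly (A - delta_mx i i) =
  char_poly A + char_poly (row' i (col' i A)).
Proof.
by rewrite -adj_form_delta -char_poly_rank1 mul_delta_mx.
Qed.

(** * The adjugate applied to the all-ones vector *)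

Lemma const_mx1_mul (R : pzSemiRingType) (n : nat) :
  (const_mx 1 : 'cV[R]_n) *m (const_mx 1 : 'cV[R]_n)^T = const_mx 1.
Proof. by apply/matrixP=> i j; rewrite !mxE big_ord1 !mxE mulr1. Qed.

(* The [i]-th coordinate of the row vector [(1, ..., 1) adj (X - A)]. *)
Definition adj_ones (R : numFieldType) (n : nat) (A : 'M[R]_n) (i : 'I_n) :
    {poly R} :=
  char_poly (A - delta_mx i 0 *m (const_mx 1 : 'cV_n)^T) - char_poly A.

Lemma sum_adj_ones (R : numFieldType) (n : nat) (A : 'M[R]_n) :
  \sum_i adj_ones A i = char_poly (A - const_mx 1) - char_poly A.
Proof.
rewrite -const_mx1_mul char_poly_rank1 [RHS]addrC addKr.
transitivity (\sum_i adj_form A (const_mx 1)^T (delta_mx i 0)).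
  by apply: eq_bigr => i _; rewrite /adj_ones char_poly_rank1 [LHS]addrC addKr.
rewrite /adj_form -summxE -mulmx_sumr -map_mx_sum.
congr ((_ *m map_mx _ _) _ _); apply/matrixP=> i j; rewrite summxE mxE ord1.
rewrite (bigD1 i) //= mxE !eqxx big1 ?addr0 // => k ki.
by rewrite mxE eq_sym (negPf ki).
Qed.

Lemma adj_ones_sqr (R : numFieldType) (n : nat) (A : 'M[R]_n)
    (i : 'I_n) : A^T = A ->
  adj_ones A i ^+ 2 =
  (char_poly (A - const_mx 1) - char_poly A) * char_poly (row' i (col' i A))
  - char_poly A * (char_poly (row' i (col' i (A - const_mx 1)))
                   - char_poly (row' i (col' i A))).
Proof.
move=> sA; have := char_poly_rank2_sym (delta_mx i 0) (const_mx 1) sA.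
rewrite -/(adj_ones A i) trmx_delta mul_delta_mx const_mx1_mul addrAC.
rewrite !char_poly_delta => E.
set a := _ * char_poly (A - _) in E.
rewrite -[LHS]opprK -[- (_ ^+ 2)](addKr a) -E /a; ring.
Qed.

Lemma size_adj_ones (R : numFieldType) (n : nat) (A : 'M[R]_n)
    (i : 'I_n) :
  (size (adj_ones A i) <= n)%N.
Proof. exact: size_char_polyB. Qed.

Lemma coef_adj_ones (R : numFieldType) (n : nat) (A : 'M[R]_n)
    (i : 'I_n) :
  (adj_ones A i)`_n.-1 = 1.
Proof.
rewrite coef_char_polyB /mxtrace (bigD1 i) //= big1 ?addr0 => [|j ji].
  by rewrite !mxE big_ord1 !mxE !eqxx mulr1.
by rewrite !mxE big_ord1 !mxE (negPf ji) mul0r.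
Qed.

(** * From equal decks to equal characteristic polynomials *)

Lemma char_poly_deck_const (R : numDomainType) (n : nat) (A B : 'M[R]_n) :
  (forall i, char_poly (row' i (col' i A)) = char_poly (row' i (col' i B))) ->
  exists c, char_poly A - char_poly B = c%:P.
Proof.
move=> deck; eexists; apply: deriv_eq0_polyC.
rewrite derivB !deriv_char_poly; apply/eqP; rewrite subr_eq0; apply/eqP.
exact: eq_bigr.
Qed.

Lemma eq_char_poly_deck (R : numFieldType) (n : nat) (A B : 'M[R]_n) :
  (2 < n)%N -> A^T = A -> B^T = B ->
  (forall i, char_poly (row' i (col' i A)) = char_poly (row' i (col' i B))) ->
  (forall i, char_poly (row' i (col' i (A - const_mx 1))) =
             char_poly (row' i (col' i (B - const_mx 1)))) ->
  char_poly A = char_poly B /\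
  char_poly (A - const_mx 1) = char_poly (B - const_mx 1).
Proof.
(* From here the matrices have size [n.+1] and the deleted ones size [n]. *)
case: n A B => [|n] // A B n2 sA sB deck deckJ.
have [c0 f_c0] := char_poly_deck_const deck.
have [c' F_c'] := char_poly_deck_const deckJ.
pose c1 := c' - c0.
pose G i : {poly R} := char_poly (row' i (col' i (A - const_mx 1)))
            - char_poly (row' i (col' i A)).
pose d i : {poly R} := adj_ones A i - adj_ones B i.
pose s i : {poly R} := adj_ones A i + adj_ones B i.
have ds i : d i * s i = c1 *: char_poly (row' i (col' i A)) - c0 *: G i.
  have -> : d i * s i = adj_ones A i ^+ 2 - adj_ones B i ^+ 2.
    by rewrite /d /s; ring.
  rewrite !adj_ones_sqr // -deck -deckJ /G -!mul_polyC polyCB -F_c' -f_c0; ring.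
have Gsz i : (size (G i) <= n)%N by exact: size_char_polyB.
have Gn1 i : (G i)`_n.-1 = n%:R.
  rewrite /G -[n.-1]/(n.+1.-1.-1) !raddfB /= coef_char_polyB /mxtrace.
  under eq_bigr do rewrite !mxE.
  by rewrite sumr_const card_ord.
have Dn i : (char_poly (row' i (col' i A)))`_n = 1.
  have := monicP (char_poly_monic (row' i (col' i A))).
  by rewrite /lead_coef size_char_poly.
have ssz i : (size (s i) <= n.+1)%N.
  by rewrite (leq_trans (size_polyD _ _)) // geq_max !size_adj_ones.
have sn i : (s i)`_n = 2 by rewrite coefD !(@coef_adj_ones _ n.+1).
have {ssz} ssz i : size (s i) = n.+1.
  apply/eqP; rewrite eqn_leq ssz ltnNge.
  apply/negP => /leq_sizeP/(_ n (leqnn _)).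
  by rewrite sn => /eqP; rewrite pnatr_eq0.
have s0 i : s i != 0 by rewrite -size_poly_gt0 ssz.
have dE i : d i = (c1 / 2)%:P.
  (* The product [d i * s i] has degree at most [n], while [s i] has degree exactly [n]. *)
  have dsz : (size (d i) <= 1)%N.
    have [->|d0] := eqVneq (d i) 0; first by rewrite size_poly0.
    have : (size (d i * s i)%R <= n.+1)%N.
      rewrite ds (leq_trans (size_polyD _ _)) // geq_max size_polyN.
      rewrite !(leq_trans (size_scale_leq _ _)) ?size_char_poly //.
      exact: leq_trans (Gsz i) _.
    by rewrite size_mul // ssz addnS /= -[X in (_ <= X)%N]add1n leq_add2r.
  have dC := size1_polyC dsz.
  (* At [X^n] the deleted characteristic polynomial contributes 1, [G i] nothing, and [s i] the
     factor 2. *)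
  have := congr1 (fun p : {poly R} => p`_n) (ds i).
  rewrite [in RHS]coefB !coefZ Dn (nth_default _ (Gsz i)) mulr0 subr0 mulr1.
  rewrite dC coefCM sn.
  by move=> <-; rewrite mulfK // pnatr_eq0.
have c10 : c1 = 0.
  (* The sum is also [n.+1] times [c1 / 2], so [c1 * (n.+1 - 2) = 0]. *)
  have : \sum_i d i = c1%:P.
    rewrite /d sumrB !sum_adj_ones /c1 polyCB -F_c' -f_c0; ring.
  under eq_bigr do rewrite dE.
  rewrite sumr_const card_ord -polyCMn => /polyC_inj.
  move=> E; apply/eqP.
  have /eqP : c1 * ((n.+1)%:R - 2) = 0.
    have -> : c1 * (n.+1%:R - 2) = (c1 / 2 *+ n.+1) * 2 - c1 * 2.
      by rewrite -mulr_natr; field.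
    by rewrite E subrr.
  rewrite mulf_eq0 => /orP[//|].
  by rewrite subr_eq0 eqr_nat => /eqP n1; move: n2; rewrite n1.
have c00 : c0 = 0.
  (* Now [d i = 0], so [c0 *: G i = 0], and the coefficient [n] of [G i] at [X^(n-1)] is nonzero. *)
  have := congr1 (fun p : {poly R} => p`_n.-1) (ds ord0).
  rewrite dE c10 mul0r mul0r scale0r sub0r coef0 coefN coefZ Gn1 => /esym/eqP.
  rewrite oppr_eq0 mulf_eq0 pnatr_eq0 => /orP[/eqP//|/eqP n0].
  by move: n2; rewrite n0.
split; apply/eqP; rewrite -subr_eq0; first by rewrite f_c0 c00.
by rewrite F_c' -[c'](subrK c0) -/c1 c10 c00 addr0.
Qed.

(** * Hypomorphism and shifts by the all-ones matrix *)

Lemma char_poly_perm_conj (S : comNzRingType) (n : nat) (P A : 'M[S]_n) :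
  is_perm_mx P -> char_poly (P *m A *m P^T) = char_poly A.
Proof.
case/is_perm_mxP=> s ->; have PP (T : comNzRingType) :
    perm_mx s *m (perm_mx s)^T = 1%:M :> 'M[T]_n.
  by rewrite tr_perm_mx -perm_mxM mulgV perm_mx1.
rewrite /char_poly; have -> : char_poly_mx (perm_mx s *m A *m (perm_mx s)^T) =
    perm_mx s *m char_poly_mx A *m (perm_mx s)^T :> 'M[{poly S}]_n.
  rewrite /char_poly_mx mulmxBr mulmxBl !map_mxM -map_trmx map_perm_mx.
  by rewrite mul_mx_scalar -scalemxAl PP scalemx1.
by rewrite !det_mulmx mulrAC -det_mulmx PP det1 mul1r.
Qed.

Lemma hypomorphic_char_poly (R : realType) (n : nat) (A B : 'M[R]_n) :
  hypomorphic A B -> forall i,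
  char_poly (row' i (col' i A)) = char_poly (row' i (col' i B)).
Proof.
move=> [s sP] i; have [si] := sP i; rewrite /delete_mx => ->.
by rewrite char_poly_perm_conj.
Qed.

(** Conjugation by a permutation matrix fixes the all-ones matrix, so the same permutations
    serve. *)
Lemma hypomorphic_affine (R : realType) (n : nat) (A B : 'M[R]_n) (a b : R) :
  hypomorphic A B ->
  hypomorphic (a *: A + b *: const_mx 1) (a *: B + b *: const_mx 1).
Proof.
move=> [s sP]; exists s => i; have [si siP] := sP i; split=> //.
have delE (C : 'M[R]_n) : delete_mx i (a *: C + b *: const_mx 1) =
    a *: delete_mx i C + b *: const_mx 1.
  by apply/matrixP=> j k; rewrite !mxE.
rewrite !delE siP mulmxDr mulmxDl -!scalemxAr -!scalemxAl; congr (_ + _ *: _).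
have /is_perm_mxP[p ->] := si.
by rewrite tr_perm_mx -row_permE -col_permE; apply/matrixP=> j k; rewrite !mxE.
Qed.

Lemma horner_char_polyN (S : comNzRingType) (n : nat) (A : 'M[S]_n) (x : S) :
  (char_poly (- A)).[x] = \det (A + x%:M).
Proof.
rewrite -[LHS]/(horner_eval x _) -det_map_mx; congr (\det _).
apply/matrixP=> i j; rewrite !mxE /= /horner_eval.
rewrite hornerD hornerN hornerC hornerMn hornerX; ring.
Qed.

Lemma char_poly_subJ (R : numFieldType) (n : nat) (A : 'M[R]_n) (t : R) :
  char_poly (A - t *: const_mx 1) =
  char_poly A + t *: (char_poly (A - const_mx 1) - char_poly A).
Proof.
rewrite -(const_mx1_mul R n) scalemxAl !char_poly_rank1.
rewrite [X in _ = _ + _ *: X]addrC addKr.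
congr (_ + _).
by rewrite /adj_form map_mxZ -scalemxAr mxE mul_polyC.
Qed.

(** * Geometry of good position *)

Lemma convex_hull_mulmx (R : realType) (n : nat) (u : 'I_n -> 'rV[R]_n)
    (x : 'rV[R]_n) : convex_hull (range u) x ->
  exists2 w : 'rV[R]_n, \sum_i w 0 i = 1 & x = w *m \matrix_i u i.
Proof.
move=> [m [p [a [pu _ a1 ->]]]].
have /choice[k kP] : forall i, exists j, u j = p i.
  by move=> i; have [j _ <-] := pu i; exists j.
exists (\sum_i a i *: delta_mx 0 (k i)).
  under eq_bigr do rewrite summxE.
  rewrite exchange_big /= -a1; apply: eq_bigr => i _.
  rewrite (bigD1 (k i)) //= big1 ?addr0 => [|j jk].
    by rewrite !mxE !eqxx mulr1.
  by rewrite !mxE (negPf jk) andbF mulr0.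
rewrite mulmx_suml; apply: eq_bigr => i _.
by rewrite -scalemxAl -rowE rowK kP.
Qed.

(** The affine hull contains the origin, hence is a linear subspace of dimension [n - 1] inside the
    row space of [U]. By rank-nullity the left kernel of [U] is at most a line; writing the origin
    as a convex combination provides [w] in it. *)
Lemma good_position_kernel (R : realType) (n : nat) (u : 'I_n -> 'rV[R]_n) :
  good_position u ->
  exists w : 'rV[R]_n, [/\ \sum_i w 0 i = 1, w *m (\matrix_i u i) = 0 &
    forall x : 'rV[R]_n, x *m (\matrix_i u i) = 0 -> exists c, x = c *: w].
Proof.
set U := \matrix_i u i.
move=> [[p [W [dimW affW]]] [hull0 _]].
have [w w1 wU] := convex_hull_mulmx hull0; exists w; split=> // x xU.
pose phi : 'Hom('rV[R]_n, 'rV[R]_n) := linfun (mulmxr U).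
have phiE y : phi y = y *m U by rewrite lfunE.
have aff_img y : affine_hull (convex_hull (range u)) y -> y \in limg phi.
  move=> [m [q [a [qS _ ->]]]]; apply: memv_suml => i _; apply: memvZ.
  have [v _ ->] := convex_hull_mulmx (qS i).
  by rewrite -phiE memv_img ?memvf.
have : affine_hull (convex_hull (range u)) 0.
  exists 1%N, (fun=> 0), (fun=> 1).
  by split=> [_|//|]; rewrite ?big_ord1 ?scaler0.
rewrite affW => -[w0 /= w0W pw0].
have sub : (W <= limg phi)%VS.
  apply/subvP=> y yW; apply: aff_img; rewrite affW /=.
  by exists (w0 + y); [exact: rpredD | rewrite addrA pw0 add0r].
have w_neq0 : w != 0.
  apply: contra_eq_neq w1 => ->; rewrite big1 => [|i _]; last by rewrite mxE.
  by rewrite eq_sym oner_eq0.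
have ker y : y *m U = 0 -> y \in lker phi by rewrite memv_ker phiE => ->.
have wker : (<[w]> == lker phi)%VS.
  rewrite eqEdim -memvE ker //= dim_vline w_neq0 /=.
  have := limg_ker_dim phi fullv; rewrite capfv dimvf /dim /= mul1n.
  have := dimvS sub; rewrite dimW.
  by move: (\dim (lker phi)) (\dim (limg phi)) => a b; lia.
by apply/vlineP; rewrite (eqP wker) ker.
Qed.

(** [P] is the Gram matrix [U *m U^T], so [w] lies in its kernel. If [x] is in the kernel of
    [P + J], then [|x U|^2 + (x 1)^2 = 0]; hence [x] is a multiple [c *: w] with coordinate sum
    [c = 0]. *)
Lemma good_position_det (R : realType) (n : nat) (u : 'I_n -> 'rV[R]_n)
    (P : 'M[R]_n) :
  is_presentation P u -> good_position u ->
  \det P = 0 /\ \det (P + const_mx 1) != 0.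
Proof.
move=> Pu /good_position_kernel[w [w1 wU kerU]].
set U := \matrix_i u i in wU kerU.
have PE : P = U *m U^T.
  apply/matrixP=> i j; rewrite -Pu /inner !mxE.
  by apply: eq_bigr => k _; rewrite !mxE.
split.
  apply/eqP/det0P; exists w; last by rewrite PE mulmxA wU mul0mx.
  apply: contra_eq_neq w1 => ->; rewrite big1 => [|i _]; last by rewrite mxE.
  by rewrite eq_sym oner_eq0.
apply/negP=> /det0P[x x0 xP].
pose q (m : nat) (y : 'rV[R]_m) := (y *m y^T) 0 0.
have qE m (y : 'rV[R]_m) : q m y = \sum_k y 0 k ^+ 2.
  by rewrite /q mxE; apply: eq_bigr => k _; rewrite mxE expr2.
have q_ge0 m (y : 'rV[R]_m) : 0 <= q m y.
  by rewrite qE sumr_ge0 // => k _; rewrite sqr_ge0.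
have q_eq0 m (y : 'rV[R]_m) : q m y = 0 -> y = 0.
  rewrite qE => /eqP; rewrite psumr_eq0 => [|k _]; last by rewrite sqr_ge0.
  move=> /allP y0; apply/rowP=> k; rewrite mxE; apply/eqP.
  by have := y0 k (mem_index_enum _); rewrite /= sqrf_eq0.
have : q _ (x *m U) + q _ (x *m (const_mx 1 : 'cV[R]_n)) = 0.
  have : (x *m (P + const_mx 1) *m x^T) 0 0 = 0 by rewrite xP mul0mx mxE.
  rewrite PE -(const_mx1_mul R n) mulmxDr mulmxDl mxE => <-.
  by rewrite /q !trmx_mul !mulmxA.
move/eqP; rewrite paddr_eq0 // => /andP[/eqP/q_eq0 xU /eqP/q_eq0 x1].
have [c xE] := kerU _ xU.
have : c = 0.
  have := congr1 (fun M : 'M[R]_1 => M 0 0) x1; rewrite !mxE xE.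
  under eq_bigr do rewrite !mxE mulr1.
  by rewrite -mulr_sumr w1 mulr1.
by move=> c0; move: x0; rewrite xE c0 scale0r eqxx.
Qed.

(** * Determination of the shift *)

(** The affine function [f + s * g] of [s] is the determinant of [A + lambda + s J]; it vanishes at
    [t] but not at [t + 1]. *)
Lemma good_presentation_shift (R : realType) (n : nat) (A : 'M[R]_n)
    (lambda t : R) :
  has_good_presentation (A + lambda%:M + t *: all_ones_mx R n) ->
  let f := (char_poly (- A)).[lambda] in
  let g := (char_poly (- A - const_mx 1)).[lambda] - f in
  g != 0 /\ t = - (f / g).
Proof.
move=> [u [Pu /(good_position_det Pu)[P0 PJ]]] f g.
have detE s : \det (A + lambda%:M + s *: const_mx 1) = f + s * g.
  rewrite addrAC -horner_char_polyN opprD char_poly_subJ.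
  by rewrite hornerD hornerZ hornerD hornerN.
have shift1 : A + lambda%:M + t *: all_ones_mx R n + const_mx 1 =
    A + lambda%:M + (t + 1) *: const_mx 1 by rewrite scalerDl scale1r addrA.
move: P0 PJ; rewrite shift1 !detE.
move=> f0 nz.
have g0 : g != 0.
  by apply: contra_neq nz => g0; rewrite -f0 g0 !mulr0.
by split=> //; apply: (mulIf g0); rewrite mulNr divfK //; lra.
Qed.

Theorem theorem7 (R : realType) (n : nat) (hn : (3 <= n)%N) (A B : 'M[R]_n)
    (hA : symmetric_mx A) (hB : symmetric_mx B) (hAB : hypomorphic A B)
    (lambda0 : R)
    (hlambda0 : forall lambda : R, lambda0 <= lambda ->
      exists s s' : R,
        [/\ psd_mx (A + lambda%:M + s *: all_ones_mx R n),
            has_good_presentation (A + lambda%:M + s *: all_ones_mx R n),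
            psd_mx (B + lambda%:M + s' *: all_ones_mx R n) &
            has_good_presentation (B + lambda%:M + s' *: all_ones_mx R n)])
    (lambda : R) (hlambda : lambda0 <= lambda) (t1 t2 : R)
    (hpsd1 : psd_mx (A + lambda%:M + t1 *: all_ones_mx R n))
    (hgood1 : has_good_presentation (A + lambda%:M + t1 *: all_ones_mx R n))
    (hpsd2 : psd_mx (B + lambda%:M + t2 *: all_ones_mx R n))
    (hgood2 : has_good_presentation (B + lambda%:M + t2 *: all_ones_mx R n)) :
  t1 = t2.
Proof.
(* The values [b = 0] and [b = -1] give the decks of [- A] and [- A - J]. *)
have deck b := hypomorphic_char_poly (hypomorphic_affine (-1) b hAB).
have symN (C : 'M[R]_n) : symmetric_mx C -> (- C)^T = - C.
  by rewrite /symmetric_mx linearN /= => ->.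
have [i|i|eqf eqF] := eq_char_poly_deck hn (symN _ hA) (symN _ hB).
- by have := deck 0 i; rewrite !scale0r !addr0 !scaleN1r.
- by have := deck (-1) i; rewrite !scaleN1r.
have [_ ->] := good_presentation_shift hgood1.
have [_ ->] := good_presentation_shift hgood2.
by rewrite eqf eqF.
Qed.
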